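(* Let $\{\mu_m\}$ be probability distributions on $\mathbb{R}$ and $\{\varphi_m\}$ the corresponding characteristic functions. If $\{\varphi_m\}$ is computable, then $\{\mu_m\}$ is computable.
   Context: A probability distribution is a Borel probability measure $\mu$ on $\mathbb{R}$; $\mu(f)=\int f\,d\mu$; its characteristic function is $\varphi(t)=\int_{\mathbb{R}} e^{itx}\mu(dx)$. Computability of real functions is in the sense of Pour-El and Richards: $\{f_n\}$ is computable if (i) for every computable sequence of reals $\{x_j\}$, $\{f_n(x_j)\}$ is a computable double sequence, and (ii) there is a recursive $\alpha(n,L,k)$ with $|x-y|<2^{-\alpha(n,L,k)}$, $|x|,|y|\le L$ implying $|f_n(x)-f_n(y)|<2^{-k}$; a sequence of complex-valued functions is computable iff the sequences of real parts and of imaginary parts are computable. $\{f_n\}$ is computable with compact support if it is computable and there is a recursive $L(n)$ with $f_n(x)=0$ for $|x|\ge L(n)$. $\{\mu_m\}$ is computable if $\{\mu_m(f_n)\}$ is a computable double sequence of reals for every computable sequence of real functions $\{f_n\}$ with compact support. *)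

(* Defs.v *)
From HB Require Import structures.
From mathcomp Require Import all_boot all_order all_algebra.
From mathcomp Require Import all_classical all_reals all_analysis.
From mathcomp Require Import complex.
Set Implicit Arguments.
Unset Strict Implicit.
Unset Printing Implicit Defensive.
Import Order.TTheory GRing.Theory Num.Theory.
Import numFieldNormedType.Exports.
Local Open Scope ring_scope.

(* The total recursive functions: minimization is applied only where a zero
   exists for every argument, since [f] in [recursive_min] is total. *)
Inductive recursive : forall k : nat, (k.-tuple nat -> nat) -> Prop :=
| recursive_zero k : @recursive k (fun=> 0%N)
| recursive_succ : @recursive 1 (fun v => (thead v).+1)
| recursive_proj k (i : 'I_k) : recursive (fun v => tnth v i)
| recursive_comp k m (g : m.-tuple nat -> nat)
    (h : 'I_m -> k.-tuple nat -> nat) :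
    recursive g -> (forall i, recursive (h i)) ->
    recursive (fun v => g [tuple h i v | i < m])
| recursive_rec k (g : k.-tuple nat -> nat) (h : k.+2.-tuple nat -> nat)
    (f : k.+1.-tuple nat -> nat) :
    recursive g -> recursive h ->
    (forall v : k.-tuple nat, f [tuple of 0%N :: v] = g v) ->
    (forall n (v : k.-tuple nat),
      f [tuple of n.+1 :: v] = h [tuple of n :: f [tuple of n :: v] :: v]) ->
    recursive f
| recursive_min k (g : k.+1.-tuple nat -> nat) (f : k.-tuple nat -> nat) :
    recursive g ->
    (forall v : k.-tuple nat, g [tuple of f v :: v] = 0%N) ->
    (forall (v : k.-tuple nat) n, (n < f v)%N -> g [tuple of n :: v] <> 0%N) ->
    recursive f.

Definition family1 {T : Type} (f : nat -> T) (v : 1.-tuple nat) : T :=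
  f (nth 0%N v 0).

Definition family2 {T : Type} (f : nat -> nat -> T) (v : 2.-tuple nat) : T :=
  f (nth 0%N v 0) (nth 0%N v 1).

Definition family3 {T : Type} (f : nat -> nat -> nat -> T)
    (v : 3.-tuple nat) : T :=
  f (nth 0%N v 0) (nth 0%N v 1) (nth 0%N v 2).

Definition computable_rat k (r : k.-tuple nat -> rat) : Prop :=
  exists s a b : k.-tuple nat -> nat,
    [/\ recursive s, recursive a, recursive b &
      forall v, b v <> 0%N /\ r v = (-1) ^+ s v * ((a v)%:R / (b v)%:R)].

(* A computable multiple sequence of rationals converges to [x], effectively
   in all indices; the first index is the index of convergence. *)
Definition computable_real (R : realType) k (x : k.-tuple nat -> R) : Prop :=
  exists (r : k.+1.-tuple nat -> rat) (e : k.+1.-tuple nat -> nat),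
    [/\ computable_rat r, recursive e &
      forall (v : k.-tuple nat) (N n : nat), (e [tuple of N :: v] <= n)%N ->
        `|ratr (r [tuple of n :: v]) - x v| <= 2 ^- N].

Definition computable_fun (R : realType) (f : nat -> R -> R) : Prop :=
  (forall x : nat -> R, computable_real (family1 x) ->
     computable_real (family2 (fun n j => f n (x j)))) /\
  (exists alpha : nat -> nat -> nat -> nat, recursive (family3 alpha) /\
     forall (n L k : nat) (x y : R), `|x| <= L%:R -> `|y| <= L%:R ->
       `|x - y| < 2 ^- alpha n L k -> `|f n x - f n y| < 2 ^- k).

Definition computable_cfun (R : realType) (f : nat -> R -> R[i]) : Prop :=
  computable_fun (fun n x => complex.Re (f n x)) /\
  computable_fun (fun n x => complex.Im (f n x)).

Definition computable_compact_support (R : realType) (f : nat -> R -> R) :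
    Prop :=
  computable_fun f /\
  exists L : nat -> nat, recursive (family1 L) /\
    forall n x, (L n)%:R <= `|x| -> f n x = 0.

Definition computable_distr (R : realType)
    (mu : nat -> probability (measurableTypeR R) R) : Prop :=
  forall f : nat -> R -> R, computable_compact_support f ->
    computable_real (family2 (fun m n => \int[mu m]_x f n x)).

Definition expi (R : realType) (t : R) : R[i] := Complex (cos t) (sin t).

Definition Cintegral (R : realType) (mu : probability (measurableTypeR R) R)
    (f : R -> R[i]) : R[i] :=
  Complex (\int[mu]_x complex.Re (f x)) (\int[mu]_x complex.Im (f x)).

Definition char_fun (R : realType) (mu : probability (measurableTypeR R) R)
    (t : R) : R[i] :=
  Cintegral mu (fun x => expi (t * x)).

(* Main.v *)
(** Averaging [1 - cos (t x)] over small [t] bounds the tails of [mu] by the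
    modulus of continuity of its characteristic function at 0.  On the bulk,
    [f x] is close to [f (2 ^ a * sin (x / 2 ^ a))], and the Bernstein polynomial
    of [y => f (2 ^ a * y)] evaluated at [sin (x / 2 ^ a)] is a trigonometric
    polynomial in [x] whose coefficients are computable.  Its integral is thus a
    finite combination of values of the characteristic function, and all errors
    are explicit, so the integral of [f] is an effective limit. *)

(* The characteristic function enters only through its values at finitely many dyadic points. The
   map [2 ^ a * sin (x / 2 ^ a)] sends the whole line into an interval on which one Bernstein
   polynomial serves, and a polynomial in a sine is a trigonometric polynomial. The price is
   periodicity: the approximant does not vanish where [f] does, so the compact support of [f] does
   not by itself control the tails. Being a mean of values of [f], however, the approximant obeys
   the same bound as [f], so a tail costs at most twice this bound times its mass. This lets the
   parameters be chosen without circularity: the tail radius from the bound of [f] and the modulus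
   at 0, then [a] from the radius, then the degree from [a]. The Bernstein polynomial is run as a
   random walk with success probability [(1 + sin t) / 2]. Expanding it one step at a time gives
   signed terms indexed by words over eight letters; sign, node and frequency of a term are
   recursive in the word. *)
Require Import Defs.
From mathcomp Require Import all_boot all_order all_algebra.
From mathcomp Require Import all_classical all_reals all_analysis.
From mathcomp Require Import complex.
From mathcomp Require Import measurable_realfun archimedean ring lra.
Set Implicit Arguments.
Unset Strict Implicit.
Unset Printing Implicit Defensive.
Import Order.TTheory GRing.Theory Num.Theory.
Import numFieldNormedType.Exports.

(** * Closure properties of the recursive functions *)

Local Open Scope nat_scope.

(* Lists of length [k] stand for [k]-tuples, which spares dependent types. *)
Definition recf k (F : seq nat -> nat) :=
  recursive (fun v : k.-tuple nat => F v).

Definition recl k m (G : seq nat -> seq nat) :=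
  (forall s, size s = k -> size (G s) = m) /\
  (forall i, i < m -> recf k (fun s => nth 0 (G s) i)).

Lemma eq_recf k F G : recf k F -> (forall s, size s = k -> F s = G s) ->
  recf k G.
Proof.
move=> hF FG; congr recursive: hF.
by apply/funext => v; apply: FG; rewrite size_tuple.
Qed.

Lemma recf_nth k i : i < k -> recf k (fun s => nth 0 s i).
Proof.
move=> ik; have := recursive_proj (Ordinal ik).
congr recursive; by apply/funext => v; rewrite (tnth_nth 0).
Qed.

Lemma recf_comp k m F G : recf m F -> recl k m G -> recf k (fun s => F (G s)).
Proof.
move=> hF [sG hG].
have := @recursive_comp k m _ (fun i v => nth 0 (G v) i) hF
  (fun i => hG i (ltn_ord i)).
congr recursive; apply/funext => v; congr F.
apply: (@eq_from_nth _ 0) => [|i].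
  by rewrite size_tuple sG // size_tuple.
rewrite size_tuple => im.
by have := tnth_mktuple (fun j : 'I_m => nth 0 (G v) j) (Ordinal im); rewrite (tnth_nth 0).
Qed.

Lemma recl_nil k : recl k 0 (fun=> [::]).
Proof. by []. Qed.

Lemma recl_cons k m a G :
  recf k a -> recl k m G -> recl k m.+1 (fun s => a s :: G s).
Proof.
move=> ha [sG hG]; split=> [s ss|[|i] /= im]; first by rewrite /= sG.
- exact: ha.
- exact: hG.
Qed.

Lemma recl_drop k j : recl (j + k) k (drop j).
Proof.
split=> [s ss|i ik]; first by rewrite size_drop ss addKn.
apply: (@eq_recf _ (fun s => nth 0 s (j + i))).
  by apply: recf_nth; rewrite ltn_add2l.
by move=> s _; rewrite nth_drop.
Qed.

Lemma recl_id k : recl k k id.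
Proof. by split=> // i; apply: recf_nth. Qed.

Lemma recl_behead k : recl k.+1 k behead.
Proof.
split=> [s ss|i ik]; first by rewrite size_behead ss.
apply: (@eq_recf _ (fun s => nth 0 s i.+1)); first exact: recf_nth.
by move=> s _; rewrite nth_behead.
Qed.

Lemma recf_at k m p a G : recf m.+1 p -> recf k a -> recl k m G ->
  recf k (fun s => p (a s :: G s)).
Proof. by move=> hp ha hG; apply: (recf_comp hp); apply: recl_cons. Qed.

Lemma recf_behead k p : recf k p -> recf k.+1 (fun s => p (behead s)).
Proof. by move=> hp; apply: (recf_comp hp); apply: recl_behead. Qed.

Lemma recl_comp_behead k m G : recl k m G -> recl k.+1 m (fun s => G (behead s)).
Proof.
case=> sG hG; split=> [s ss|i im]; first by rewrite sG // size_behead ss.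
exact: (recf_behead (hG i im)).
Qed.

Lemma recf_succ k a : recf k a -> recf k (fun s => (a s).+1).
Proof.
move=> ha; have h : recf 1 (fun s => (head 0 s).+1).
  have := recursive_succ; congr recursive; apply/funext => v.
  by case/tupleP: v.
exact: (recf_comp h (recl_cons ha (recl_nil k))).
Qed.

Lemma recf_const k c : recf k (fun=> c).
Proof.
elim: c => [|c IH]; first exact: recursive_zero.
exact: recf_succ IH.
Qed.

(** With [nat_rect] as recursor both equations of primitive recursion hold by computation, so the
    uses below reduce to inductions on the number of steps. *)
Lemma recf_rec k z h n : recf k z -> recf k.+2 h -> recf k n ->
  recf k (fun s => nat_rect (fun=> nat) (z s) (fun i r => h [:: i, r & s]) (n s)).
Proof.
move=> hz hh hn.
have H : recf k.+1 (fun s => nat_rect (fun=> nat) (z (behead s))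
    (fun i r => h [:: i, r & behead s]) (head 0 s)).
  exact: (recursive_rec hz hh).
exact: (recf_comp H (recl_cons hn (recl_id k))).
Qed.

Lemma recf_min k g f : recf k.+1 g ->
  (forall s, size s = k -> g (f s :: s) = 0) ->
  (forall s n, size s = k -> n < f s -> g (n :: s) <> 0) -> recf k f.
Proof.
move=> hg h0 h1; apply: (recursive_min hg) => [v|v n].
  by apply: h0; rewrite size_tuple.
by apply: h1; rewrite size_tuple.
Qed.

Section Arithmetic.
Variables (k : nat) (a b : seq nat -> nat).
Hypotheses (ha : recf k a) (hb : recf k b).

Lemma recf_add : recf k (fun s => a s + b s).
Proof.
apply: (eq_recf (recf_rec hb (recf_succ (@recf_nth k.+2 1 isT)) ha)) => s _.
by elim: (a s) => //= n ->.
Qed.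

Lemma recf_pred : recf k (fun s => (a s).-1).
Proof.
apply: (eq_recf (recf_rec (recf_const k 0) (@recf_nth k.+2 0 isT) ha)) => s _.
by case: (a s).
Qed.

End Arithmetic.

Lemma recf_subn k a b : recf k a -> recf k b -> recf k (fun s => a s - b s).
Proof.
move=> ha hb.
apply: (eq_recf (recf_rec ha (recf_pred (@recf_nth k.+2 1 isT)) hb)) => s _.
by elim: (b s) => [|n /= ->]; rewrite ?subn0 // subnS.
Qed.

Lemma recf_sum k F n : recf k.+1 F -> recf k n ->
  recf k (fun s => \sum_(i < n s) F (nat_of_ord i :: s)).
Proof.
move=> hF hn.
have hh : recf k.+2 (fun s => nth 0 s 1 + F (nth 0 s 0 :: drop 2 s)).
  apply: recf_add; first exact: recf_nth.
  apply: (recf_comp hF); apply: recl_cons; first exact: recf_nth.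
  exact: (recl_drop k 2).
apply: (eq_recf (recf_rec (recf_const k 0) hh hn)) => s _.
by elim: (n s) => [|m /= ->]; rewrite ?big_ord0 // big_ord_recr /= drop0.
Qed.

Lemma recf_mul k a b : recf k a -> recf k b -> recf k (fun s => a s * b s).
Proof.
move=> ha hb.
have h : recf k.+1 (fun s => b (behead s)).
  exact: (recf_comp hb (recl_behead k)).
by apply: (eq_recf (recf_sum h ha)) => s _ /=; rewrite sum_nat_const card_ord.
Qed.

Lemma recf_exp k a b : recf k a -> recf k b -> recf k (fun s => a s ^ b s).
Proof.
move=> ha hb.
have hh : recf k.+2 (fun s => a (drop 2 s) * nth 0 s 1).
  apply: recf_mul; last exact: recf_nth.
  exact: (recf_comp ha (recl_drop k 2)).
apply: (eq_recf (recf_rec (recf_const k 1) hh hb)) => s _.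
by elim: (b s) => //= n ->; rewrite drop0 expnS.
Qed.

Lemma recf_leq k a b : recf k a -> recf k b ->
  recf k (fun s => (a s <= b s) : nat).
Proof.
move=> ha hb.
apply: (eq_recf (recf_subn (recf_const k 1) (recf_subn ha hb))) => s _.
by rewrite /leq; case: (a s - b s).
Qed.

Lemma recf_eqn k a b : recf k a -> recf k b ->
  recf k (fun s => (a s == b s) : nat).
Proof.
move=> ha hb.
apply: (eq_recf (recf_mul (recf_leq ha hb) (recf_leq hb ha))) => s _.
by rewrite eqn_leq mulnb.
Qed.

Lemma recf_div k a b : recf k a -> recf k b -> recf k (fun s => a s %/ b s).
Proof.
move=> ha hb.
have ha' := recf_comp ha (recl_behead k).
have hb' := recf_comp hb (recl_behead k).
have h0 : recf k.+1 (fun s => nth 0 s 0) by exact: recf_nth.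
pose t (s : seq nat) := (nth 0 s 0).+1 * b (behead s) <= a (behead s).
(* The factor [0 < b] stops the search at 0 for a zero divisor, in agreement with [divn0]. *)
have ht : recf k.+1 (fun s => (0 < b (behead s)) * t s).
  apply: recf_mul; first by apply: recf_leq => //; exact: recf_const.
  by apply: recf_leq => //; apply: recf_mul => //; exact: recf_succ.
apply: (recf_min ht) => [s _|s n _]; rewrite /t /=.
  case: (posnP (b s)) => [->|b0] //; rewrite mul1n leqNgt ltn_ceil //.
case: (posnP (b s)) => [->|b0]; first by rewrite divn0.
by rewrite mul1n -leq_divRL // => ->.
Qed.

Lemma recf_mod k a b : recf k a -> recf k b -> recf k (fun s => a s %% b s).
Proof.
move=> ha hb.
apply: (eq_recf (recf_subn ha (recf_mul (recf_div ha hb) hb))) => s _.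
by rewrite {1}(divn_eq (a s) (b s)) addKn.
Qed.

Ltac recf_tac := repeat first
  [ exact: recf_const | by apply: recf_nth | assumption
  | apply: recf_succ | apply: recf_add | apply: recf_subn | apply: recf_mul
  | apply: recf_exp | apply: recf_leq | apply: recf_eqn | apply: recf_div
  | apply: recf_mod ].

Lemma recf_logn k p a : prime p -> recf k a -> recf k (fun s => logn p (a s)).
Proof.
move=> pp ha.
have ha' := recf_comp ha (recl_behead k).
(* The search finds the least [n] such that [p ^ n.+1] does not divide [a]; the first factor makes
   it return 0 at [a = 0], as [logn] does. *)
have ht : recf k.+1 (fun s => (0 < a (behead s)) *
   (a (behead s) %% p ^ (nth 0 s 0).+1 == 0)) by recf_tac.
apply: (recf_min ht) => [s _|s n _] /=; case: (posnP (a s)) => [->|a0].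
- by [].
- by rewrite mul1n -/(_ %| _) pfactor_dvdn // ltnn.
- by rewrite logn0.
- by rewrite mul1n -/(_ %| _) pfactor_dvdn // => ->.
Qed.

(** * Computable families of reals and their closure properties *)

Local Open Scope ring_scope.

(* [computable_real] with the approximations normalized to the dyadic numbers
   of denominator [2 ^ N.+1]; see [creal_of_computable]. *)
Definition creal (R : realType) k (X : seq nat -> R) := exists p q,
  [/\ recf k.+1 p, recf k.+1 q & forall s N, size s = k ->
    `|((p (N :: s))%:R - (q (N :: s))%:R) / 2 ^+ N.+1 - X s| <= 2 ^- N].

Section Creal.
Variable R : realType.
Implicit Types (X Y : seq nat -> R) (k : nat).

Lemma natr_divn (a d : nat) : (0 < d)%N ->
  0 <= a%:R / d%:R - (a %/ d)%N%:R :> R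
  /\ a%:R / d%:R - (a %/ d)%N%:R < 1 :> R.
Proof.
move=> d0; have d0' : 0 < d%:R :> R by rewrite ltr0n.
rewrite subr_ge0 ltrBlDr -(natrD _ 1) ler_pdivlMr // ltr_pdivrMr //.
by rewrite -!natrM ler_nat ltr_nat leq_divM add1n; split=> //; rewrite ltn_ceil.
Qed.

Lemma natr_ltX2 n : n%:R < 2 ^+ n :> R.
Proof. by rewrite -natrX ltr_nat ltn_expl. Qed.

Lemma invX2_gt0 n : 0 < 2 ^- n :> R.
Proof. by rewrite invr_gt0 exprn_gt0. Qed.

Lemma invX2S n : 2 ^- n = 2 ^- n.+1 + 2 ^- n.+1 :> R.
Proof. by rewrite exprS invfM; field; rewrite expf_neq0. Qed.

Lemma ler_invX2 m n : (m <= n)%N -> 2 ^- n <= 2 ^- m :> R.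
Proof. by move=> mn; rewrite lef_pV2 ?posrE ?exprn_gt0 // ler_eXn2l // ltr1n. Qed.

(** The given approximation is taken at precision [N.+1] and both numerators are rounded down to
    multiples of [2 ^- N.+1]. The two rounding errors have the same sign, so their difference stays
    below [2 ^- N.+1], the other half of the allowance. *)
Lemma creal_intro k X p q d :
  recf k.+1 p -> recf k.+1 q -> recf k.+1 d ->
  (forall s N, size s = k -> d (N :: s) != 0%N /\
     `|((p (N :: s))%:R - (q (N :: s))%:R) / (d (N :: s))%:R - X s| <= 2 ^- N) ->
  creal k X.
Proof.
move=> hp hq hd H.
pose sh (s : seq nat) := (nth 0%N s 0).+1 :: behead s.
have hsh : recl k.+1 k.+1 sh.
  by apply: recl_cons; [recf_tac | apply: recl_behead].
pose r p s := (p (sh s) * 2 ^ (nth 0%N s 0).+1 %/ d (sh s))%N.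
have hr p' : recf k.+1 p' -> recf k.+1 (r p').
  move=> h; have := recf_comp h hsh; have := recf_comp hd hsh.
  by move=> ? ?; rewrite /r; recf_tac.
exists (r p), (r q); split; [exact: hr|exact: hr|] => s N ss.
have [d0 Hs] := H s N.+1 ss; rewrite /r /sh /=.
move: (p _) (q _) (d _) d0 Hs => {p q d r hr sh hsh H hp hq hd} a b d.
rewrite -lt0n => d0 H.
have d0' : d%:R != 0 :> R by rewrite pnatr_eq0 -lt0n.
have := natr_divn (a * 2 ^ N.+1) d0; have := natr_divn (b * 2 ^ N.+1) d0.
move: (_ %/ _)%N (_ %/ _)%N => v u; rewrite !natrM !natrX !(mulrAC _ (2 ^+ _)).
have E0 : 0 < 2 ^+ N.+1 :> R by rewrite exprn_gt0.
have EV := mulfV (lt0r_neq0 E0); have V0 := invX2_gt0 N.+1.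
rewrite (invX2S N); move: H; rewrite mulrBl.
move: (2 ^+ N.+1) (2 ^- N.+1) EV E0 V0 (a%:R / _) (b%:R / _) => E V EV E0 V0 x y.
rewrite !ler_norml => /andP[H1 H2] [H3 H4] [H5 H6].
have : 0 <= (y - u%:R * V).
  by have := mulr_ge0 H3 (ltW V0); rewrite mulrBl -mulrA EV mulr1.
have : 0 <= (x - v%:R * V).
  by have := mulr_ge0 H5 (ltW V0); rewrite mulrBl -mulrA EV mulr1.
have : (y - u%:R * V) < V.
  by have := H4; rewrite -(ltr_pM2r V0) mul1r mulrBl -mulrA EV mulr1.
have : (x - v%:R * V) < V.
  by have := H6; rewrite -(ltr_pM2r V0) mul1r mulrBl -mulrA EV mulr1.
rewrite mulrBl => *; apply/andP; split; lra.
Qed.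

Lemma eq_creal k X Y : creal k X -> (forall s, size s = k -> X s = Y s) ->
  creal k Y.
Proof.
by move=> [p [q [hp hq H]]] XY; exists p, q; split=> // s N ss; rewrite -XY ?H.
Qed.

Lemma creal_comp k m X G : creal m X -> recl k m G -> creal k (fun s => X (G s)).
Proof.
move=> [p [q [hp hq H]]] hG.
have hG' := recl_comp_behead hG.
have h p' : recf m.+1 p' -> recf k.+1 (fun s => p' (nth 0%N s 0 :: G (behead s))).
  by move=> hp'; apply: (recf_at hp' (@recf_nth k.+1 0 isT) hG').
do 2 eexists; split; [exact: h hp|exact: h hq|] => s N ss /=.
by apply: H; case: hG => /(_ s ss).
Qed.

Lemma creal_dyadic k a b c : recf k a -> recf k b -> recf k c ->
  creal k (fun s => ((a s)%:R - (b s)%:R) / 2 ^+ c s : R).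
Proof.
move=> ha hb hc; have hc' := recf_behead hc.
apply: (creal_intro (recf_behead ha) (recf_behead hb)
  (recf_exp (recf_const k.+1 2) hc')) => s N _.
rewrite -lt0n expn_gt0; split=> //.
by rewrite natrX subrr normr0 ltW // invX2_gt0.
Qed.

Lemma creal_int k a b : recf k a -> recf k b ->
  creal k (fun s => (a s)%:R - (b s)%:R : R).
Proof.
move=> ha hb; apply: (eq_creal (creal_dyadic ha hb (recf_const k 0))) => s _.
by rewrite expr0 divr1.
Qed.

Lemma creal_add k X Y : creal k X -> creal k Y -> creal k (fun s => X s + Y s).
Proof.
move=> [p [q [hp hq H]]] [p' [q' [hp' hq' H']]].
have h r : recf k.+1 r -> recf k.+1 (fun s => r ((nth 0%N s 0).+1 :: behead s)).
  by move=> hr; apply: (recf_at hr _ (recl_behead k)); recf_tac.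
have hN : recf k.+1 (fun s => nth 0%N s 0) by exact: recf_nth.
apply: (creal_intro (recf_add (h _ hp) (h _ hp')) (recf_add (h _ hq) (h _ hq'))
  (recf_exp (recf_const k.+1 2) (recf_succ (recf_succ hN)))) => s N ss.
rewrite -lt0n expn_gt0; split=> //; rewrite natrX /=.
have := H s N.+1 ss; have := H' s N.+1 ss; rewrite !natrD (invX2S N).
rewrite !mulrBl mulrDl opprD mulrDl !ler_norml.
by move=> /andP[? ?] /andP[? ?]; apply/andP; split; lra.
Qed.

Lemma creal_mul k X Y : creal k X -> creal k Y -> creal k (fun s => X s * Y s).
Proof.
move=> [p [q [hp hq H]]] [p' [q' [hp' hq' H']]].
pose B p q s : nat := ((p (0 :: behead s) + q (0 :: behead s)).+1)%N.
have hB r r' : recf k.+1 r -> recf k.+1 r' -> recf k.+1 (B r r').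
  move=> hr hr'; apply: recf_succ; apply: recf_add.
    exact: (recf_at hr (recf_const _ 0) (recl_behead k)).
  exact: (recf_at hr' (recf_const _ 0) (recl_behead k)).
(* [B], read off the approximations at precision 0, bounds the factors. The product then errs by at
   most [B + B' + 1] times the error of a factor, which the extra precision absorbs because
   [m < 2 ^ m]. *)
pose M s : nat := (nth 0%N s 0 + (B p q s + B p' q' s).+1)%N.
have hM : recf k.+1 M.
  apply: recf_add; first exact: recf_nth.
  by apply: recf_succ; apply: recf_add; exact: hB.
have h r : recf k.+1 r -> recf k.+1 (fun s => r (M s :: behead s)).
  by move=> hr; apply: (recf_at hr hM (recl_behead k)).
have D0 : recf k.+1 (fun s => 2 ^ (M s).+1 * 2 ^ (M s).+1)%N by recf_tac.
apply: (creal_intro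
  (recf_add (recf_mul (h _ hp) (h _ hp')) (recf_mul (h _ hq) (h _ hq')))
  (recf_add (recf_mul (h _ hp) (h _ hq')) (recf_mul (h _ hq) (h _ hp')))
  D0) => s N ss.
rewrite -lt0n muln_gt0 expn_gt0; split=> //.
have bound (Z : seq nat -> R) r r' : (forall s N, size s = k ->
    `|((r (N :: s))%:R - (r' (N :: s))%:R) / 2 ^+ N.+1 - Z s| <= 2 ^- N) ->
    `|Z s| <= (B r r' (N :: s))%:R.
  move=> /(_ s 0 ss); rewrite /B /= expr0 invr1 expr1 -[X in _ -> _ <= X]natr1 natrD.
  have := ler0n R (r (0%N :: s)); have := ler0n R (r' (0%N :: s)).
  by rewrite !ler_norml => ? ? /andP[? ?]; apply/andP; split; lra.
have := bound _ _ _ H; have := bound _ _ _ H'.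
have := H s (M (N :: s)) ss; have := H' s (M (N :: s)) ss.
rewrite !natrM !natrD !natrM natrX /M /=.
set b := B p q _; set b' := B p' q' _; set n := (_ + _)%N.
have nb : (b%:R + b'%:R + 1) * 2 ^- n <= 2 ^- N :> R.
  rewrite /n exprD invfM mulrCA ler_piMr ?(ltW (invX2_gt0 _)) //.
  by rewrite ler_pdivrMr ?exprn_gt0 // mul1r -natrD natr1 ltW // natr_ltX2.
have n1 : 2 ^- n <= 1 :> R.
  by rewrite -[leRHS]invr1 -(expr0 2) ler_invX2.
have bs0 := ler0n R b; have b's0 := ler0n R b'.
move: nb n1; move: (2 ^- n) (invX2_gt0 n) => e e0 nb n1 HY HX b'Y bX.
set x := (_ - _) / _ in HX; set y := (_ - _) / _ in HY.
have -> : forall a c d f E : R, (a * c + d * f - (a * f + d * c)) / (E * E) =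
    ((a - d) / E) * ((c - f) / E).
  by move=> a c d f E; rewrite invfM; ring.
rewrite -/x -/y.
have -> : x * y - X s * Y s = X s * (y - Y s) + y * (x - X s) by ring.
have yb : `|y| <= b'%:R + 1.
  rewrite -(subrK (Y s) y); apply: le_trans (ler_normD _ _) _.
  by rewrite [leRHS]addrC lerD // (le_trans HY).
move: x y HX HY yb => x y HX HY yb.
apply: le_trans (ler_normD _ _) _; rewrite !normrM; apply: le_trans nb.
rewrite -addrA mulrDl; apply: lerD; apply: ler_pM => //.
Qed.

Lemma creal_sum k X n : creal k.+1 X -> recf k n ->
  creal k (fun s => \sum_(i < n s) X (nat_of_ord i :: s)).
Proof.
move=> [p [q [hp hq H]]] hn.
pose M s : nat := (nth 0%N s 0 + n (behead s))%N.
have hM : recf k.+1 M by apply: recf_add; [exact: recf_nth|exact: recf_behead].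
pose S r s : nat := (\sum_(i < n (behead s))
  r [:: M s, nat_of_ord i & behead s])%N.
have hS r : recf k.+2 r -> recf k.+1 (S r).
  move=> hr; pose r' s := r [:: M (behead s), nth 0%N s 0 & behead (behead s)].
  apply: (@eq_recf _ (fun s => (\sum_(i < n (behead s)) r' (nat_of_ord i :: s))%N)) => //.
  apply: (recf_sum _ (recf_behead hn)).
  apply: (recf_at hr (recf_behead hM)); apply: recl_cons; first exact: recf_nth.
  exact: (recl_comp_behead (recl_behead k)).
have D0 : recf k.+1 (fun s => 2 ^ (M s).+1)%N by recf_tac.
apply: (creal_intro (hS _ hp) (hS _ hq) D0) => s N ss.
rewrite -lt0n expn_gt0; split=> //.
rewrite /S natrX /M /= !natr_sum -sumrB mulr_suml -sumrB.
apply: le_trans (ler_norm_sum _ _ _) _.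
apply: le_trans (_ : \sum_(i < n s) 2 ^- (N + n s) <= _).
  by apply: ler_sum => i _; apply: H; rewrite /= ss.
rewrite sumr_const card_ord -[leLHS]mulr_natl exprD invfM mulrCA.
rewrite ler_piMr ?(ltW (invX2_gt0 _)) //.
by rewrite ler_pdivrMr ?exprn_gt0 // mul1r ltW // natr_ltX2.
Qed.

Lemma creal_lim k X Y : creal k.+1 Y ->
  (forall s N, size s = k -> `|Y (N :: s) - X s| <= 2 ^- N) -> creal k X.
Proof.
move=> [p [q [hp hq H]]] YX.
have hN : recf k.+1 (fun s => (nth 0%N s 0).+1) by recf_tac.
have h r : recf k.+2 r -> recf k.+1 (fun s => r
    [:: (nth 0%N s 0).+1, (nth 0%N s 0).+1 & behead s]).
  by move=> hr; apply: (recf_at hr hN (recl_cons hN (recl_behead k))).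
apply: (creal_intro (h _ hp) (h _ hq)
  (recf_exp (recf_const k.+1 2) (recf_succ hN))) => s N ss.
rewrite -lt0n expn_gt0; split=> //; rewrite natrX /=.
have := H (N.+1 :: s) N.+1; rewrite /= ss => /(_ erefl); have := YX s N.+1 ss.
rewrite (invX2S N) !ler_norml.
by move=> /andP[? ?] /andP[? ?]; apply/andP; split; lra.
Qed.

Lemma creal_of_computable k X :
  computable_real (fun v : k.-tuple nat => X v) -> creal k X.
Proof.
move=> [r [e [[sg [a [b [hsg ha hb rE]]]] he H]]].
have mk m (f : m.-tuple nat -> nat) : recursive f ->
    exists2 F, recf m F & forall v : m.-tuple nat, F v = f v.
  move=> hf; pose F (s : seq nat) := f (insubd [tuple 0%N | i < m] s).
  have FE (v : m.-tuple nat) : F v = f v by rewrite /F valKd.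
  by exists F => //; congr recursive: hf; apply/funext.
have [SG hSG SGE] := mk _ _ hsg; have [A hA AE] := mk _ _ ha.
have [B hB BE] := mk _ _ hb; have [E hE EE] := mk _ _ he.
(* Putting the index of convergence in place of the precision leaves an error of at most [2 ^- N] at
   [N]. *)
pose sE (s : seq nat) := E s :: behead s.
have h F : recf k.+1 F -> recf k.+1 (fun s => F (sE s)).
  by move=> hF; apply: (recf_at hF hE (recl_behead k)).
have := h _ hSG; have := h _ hA; have := h _ hB => hB' hA' hSG'.
have h1 : recf k.+1 (fun s => A (sE s) * (SG (sE s) %% 2 == 0))%N by recf_tac.
have h2 : recf k.+1 (fun s => A (sE s) * (SG (sE s) %% 2 == 1))%N by recf_tac.
apply: (creal_intro h1 h2 hB') => s N ss.
pose v : k.-tuple nat := Tuple (introT eqP ss).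
have := H v N (E (N :: s)).
pose w := [tuple of E (N :: s) :: v].
have -> : E (N :: s) = e [tuple of N :: v] by rewrite -EE.
move=> /(_ (leqnn _)); rewrite -EE /=.
have [b0 rEw] := rE w.
have ws : sE (N :: s) = w by [].
rewrite !ws !AE !SGE BE; split; first exact/eqP.
suff -> : ((a w * (sg w %% 2 == 0))%N%:R - (a w * (sg w %% 2 == 1))%N%:R) /
  (b w)%:R = ratr (r w) :> R by [].
rewrite rEw (rmorphM (@ratr R)) (fmorph_div (@ratr R)) /= !ratr_nat rmorphXn rmorphN1 /=.
rewrite -signr_odd modn2; case: odd; rewrite /= ?muln0 ?muln1.
  by rewrite expr1 sub0r mulN1r mulNr.
by rewrite expr0 subr0 mul1r.
Qed.

Lemma computable_of_creal k X :
  creal k X -> computable_real (fun v : k.-tuple nat => X v).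
Proof.
move=> [p [q [hp hq H]]].
have hN : recf k.+1 (fun s => nth 0%N s 0) by exact: recf_nth.
(* Subtraction being truncated, one summand vanishes and [a] is the absolute difference. *)
pose a s := (p s - q s + (q s - p s))%N.
pose b s := (2 ^ (nth 0%N s 0).+1)%N; pose sg s := (p s < q s)%N : nat.
exists (fun v => (-1) ^+ sg v * ((a v)%:R / (b v)%:R)), (fun v => nth 0%N v 0).
split=> [|//|v N n /= Nn].
  exists (fun v => sg v), (fun v => a v), (fun v => b v); split.
  - by rewrite -/(recf _ sg) /sg; recf_tac.
  - by rewrite -/(recf _ a) /a; recf_tac.
  - by rewrite -/(recf _ b) /b; recf_tac.
  - by move=> v; split=> //; apply/eqP; rewrite -lt0n expn_gt0.
apply: le_trans (ler_invX2 Nn).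
have := H v n; rewrite size_tuple => /(_ erefl).
set y := _ / 2 ^+ _; set z := ratr _; suff -> : z = y by []; rewrite /y /z.
rewrite (rmorphM (@ratr R)) (fmorph_div (@ratr R)) /= !ratr_nat rmorphXn rmorphN1 /a /b /sg /= natrX mulrA.
congr (_ / _).
move: (p _) (q _) => {z y H hp hq a b sg p q hN} p q; case: ltnP => [/ltnW|] pq.
  have /eqP -> : (p - q == 0)%N by rewrite subn_eq0.
  by rewrite add0n natrB // mulN1r opprB.
have /eqP -> : (q - p == 0)%N by rewrite subn_eq0.
by rewrite addn0 natrB // mul1r.
Qed.

(* The arguments [(u - d) / 2 ^ c] form a single computable sequence when the
   triple is coded by [2 ^ u * 3 ^ d * 5 ^ c]. *)
Lemma creal_fun_dyadic k (f : nat -> R -> R) n u d c : computable_fun f ->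
  recf k n -> recf k u -> recf k d -> recf k c ->
  creal k (fun s => f (n s) (((u s)%:R - (d s)%:R) / 2 ^+ c s)).
Proof.
move=> [hf _] hn hu hd hc.
pose x j : R := ((logn 2 j)%:R - (logn 3 j)%:R) / 2 ^+ logn 5 j.
have hx : computable_real (family1 x).
  apply: (computable_of_creal (X := fun s => x (nth 0%N s 0)%N)).
  have h0 : recf 1 (fun s => nth 0%N s 0) by exact: recf_nth.
  by apply: creal_dyadic; exact: recf_logn.
have hj : recf k (fun s => 2 ^ u s * 3 ^ d s * 5 ^ c s)%N by recf_tac.
have := creal_of_computable (X := fun s => f (nth 0%N s 0)%N (x (nth 0%N s 1)%N)) (hf x hx).
move=> /creal_comp => /(_ _ _ (recl_cons hn (recl_cons hj (recl_nil k)))).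
move=> h; apply: (eq_creal h) => s _ /=; congr (f _ _).
by rewrite /x !lognM ?muln_gt0 ?expn_gt0 // !lognX !logn_prime // !muln0 !muln1
  !addn0 !add0n.
Qed.

End Creal.


(** * Elementary estimates for sine and cosine, and the shifted cosines *)

Section Trigonometry.
Variable R : realType.
Implicit Types x y : R.

Lemma derive_le1_lip (f df : R -> R) x y : (forall z : R, is_derive z 1 f (df z)) ->
  (forall z, `|df z| <= 1) -> `|f x - f y| <= `|x - y|.
Proof.
move=> fd df1; wlog yx : x y / y <= x => [H|].
  by case/orP: (le_total x y) => /H //; rewrite distrC (distrC y).
have [|c _ ->] := @MVT_segment R f df y x yx (fun z _ => fd z).
  apply: continuous_subspaceT => z; apply: differentiable_continuous.
  by apply/derivable1_diffP; have := fd z.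
by rewrite normrM ler_piMl.
Qed.

Lemma cos_lip x y : `|cos x - cos y| <= `|x - y|.
Proof. by apply: (@derive_le1_lip _ (fun z => - sin z)) => z; rewrite normrN sin_max. Qed.

(** By the mean value theorem [sin x = x * cos c] with [c] between 0 and [x], and [cos] is
    1-Lipschitz. A quadratic rate is enough to make [2 ^ a * sin (x / 2 ^ a)] tend to [x]. *)
Lemma sin_near x : `|sin x - x| <= x ^+ 2.
Proof.
wlog x0 : x / 0 <= x => [H|].
  case/orP: (le_total 0 x) => [/H //|x0]; have := H (- x).
  by rewrite sinN -opprD normrN sqrrN oppr_ge0; apply.
have [|c] := @MVT_segment R sin cos 0 x x0 (fun z _ => is_derive_sin z).
  by apply: continuous_subspaceT; exact: continuous_sin.
rewrite in_itv /= sin0 !subr0 => /andP[c0 cx] ->.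
rewrite -[X in _ - X]mul1r -mulrBl normrM (ger0_norm x0) ler_wpM2r //.
by rewrite -cos0; apply: le_trans (cos_lip _ _) _; rewrite subr0 ger0_norm.
Qed.

Lemma sin_ge_half x : `|x| <= 2^-1 -> `|x| / 2 <= `|sin x|.
Proof.
move=> x2; have := sin_near x; rewrite distrC -[leRHS]ger0_norm ?sqr_ge0 // normrX => h.
have := ler_normD (sin x) (x - sin x).
have : `|x| ^+ 2 <= `|x| / 2 by rewrite expr2 ler_wpM2l.
rewrite [sin x + _]addrC subrK; lra.
Qed.

(** Telescoping of [2 * sin x * cos ((2 * j + 1) * x) = sin ((2 * j + 2) * x) - sin (2 * j * x)]. *)
Lemma sum_cos_odd x N :
  2 * sin x * \sum_(j < N) cos (j.*2.+1%:R * x) = sin (N.*2%:R * x).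
Proof.
elim: N => [|N IH]; first by rewrite big_ord0 mulr0 mul0r sin0.
rewrite big_ord_recr mulrDr IH /=.
have -> : N.*2.+1%:R * x = N.*2%:R * x + x by rewrite -natr1 mulrDl mul1r.
have -> : N.+1.*2%:R * x = N.*2%:R * x + x + x.
  by rewrite doubleS -!natr1 !mulrDl mul1r.
rewrite !(sinD, cosD); have := cos2Dsin2 x; set s := sin x; set c := cos x.
move: (sin _) (cos _) => S C cs.
have -> : (S * c + C * s) * c + (C * c - S * s) * s =
  S * (c ^+ 2 + s ^+ 2) + 2 * s * (C * c - S * s) by ring.
by rewrite cs mulr1.
Qed.

(** The closed form is at most [1 / (2 * |sin x|)], hence at most [1 / |x|], in absolute value. A
    mean over equally spaced nodes stands in for the mean over an interval of [t], so that linearity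
    alone moves it past the integral. *)
Lemma sum_cos_odd_le x N : `|x| <= 2^-1 -> 2 <= N%:R * `|x| ->
  \sum_(j < N) cos (j.*2.+1%:R * x) <= N%:R / 2.
Proof.
move=> x2 Nx; have := sum_cos_odd x N; set S := \sum_(_ < _) _ => SE.
apply: le_trans (ler_norm _) _; have := sin_ge_half x2.
have := sin_max (N.*2%:R * x); rewrite -SE !normrM (ger0_norm (ler0n _ 2)).
have := normr_ge0 S; have := normr_ge0 x; have := ler0n R N.
move: `|S| `|x| `|sin x| Nx x2 => s y z Nx x2 N0 y0 s0 H1 H2.
have sy : s * y <= 1.
  by apply: le_trans H1; rewrite mulrC ler_wpM2r //; lra.
have : s * 2 <= s * (N%:R * y) by rewrite ler_wpM2l.
have : s * (N%:R * y) <= N%:R by rewrite mulrCA ler_piMr.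
lra.
Qed.

(* [quart r] and [quart' r] are the cosine and sine of r quarter turns; hence
   [rcos u d t] is the cosine of (u - d)(t - pi / 2), and the shift by pi / 2
   makes [2 * sin t] act as a sum of two index shifts. *)
Definition quart (r : nat) : R := (r %% 4 == 0)%N%:R - (r %% 4 == 2)%N%:R.
Definition quart' (r : nat) : R := (r %% 4 == 1)%N%:R - (r %% 4 == 3)%N%:R.

Definition rcos (u d : nat) (t : R) : R :=
  quart (u + 3 * d) * cos ((u%:R - d%:R) * t) +
  quart' (u + 3 * d) * sin ((u%:R - d%:R) * t).

Lemma quartS r : quart r.+1 = - quart' r /\ quart' r.+1 = quart r.
Proof.
rewrite /quart /quart' -(addn1 r) -modnDml.
have : (r %% 4 < 4)%N by rewrite ltn_mod.
by case: (r %% 4)%N => [|[|[|[|]]]] //= _; split; lra.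
Qed.

(** With [y = t - pi / 2] and [n = u - d] this is [2 * cos y * cos (n * y) = cos ((n + 1) * y) + cos
    ((n - 1) * y)]. The [3 * d] in [rcos] stands for [- d] modulo 4, three quarter turns forward
    being one backward. *)
Lemma sin_rcos u d t : 2 * sin t * rcos u d t = rcos u.+1 d t + rcos u d.+1 t.
Proof.
rewrite /rcos addSn; have -> : (u + 3 * d.+1 = (u + 3 * d).+3)%N.
  by rewrite mulnS addnCA.
have [E1 E1'] := quartS (u + 3 * d); have [E2 E2'] := quartS (u + 3 * d).+1.
have [E3 E3'] := quartS (u + 3 * d).+2.
rewrite E3 E3' E2 E2' E1 E1'.
have -> : (u.+1%:R - d%:R) * t = (u%:R - d%:R) * t + t by rewrite -natr1; ring.
have -> : (u%:R - d.+1%:R) * t = (u%:R - d%:R) * t - t by rewrite -natr1; ring.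
by rewrite !(sinD, cosD, sinN, cosN); ring.
Qed.

End Trigonometry.

(** * Bernstein polynomials as random walks, and their trigonometric expansion *)

Section Digits.
Variable t : nat -> nat.

(** The number [w] codes a word of [K] choices out of eight, and [t] is what a single choice
    contributes to a counter. *)
Definition dsum K w : nat := (\sum_(i < K) t ((w %/ 8 ^ i) %% 8))%N.

Lemma dsumS K w c : (c < 8)%N -> dsum K.+1 (8 * w + c) = (t c + dsum K w)%N.
Proof.
move=> c8; rewrite /dsum big_ord_recl /=; congr addn.
  by rewrite divn1 mulnC modnMDl modn_small.
by apply: eq_bigr => i _; rewrite /bump /= expnS divnMA mulnC divnMDl // (divn_small c8) addn0.
Qed.

End Digits.

Lemma sum_mul8 (V : zmodType) (f : nat -> V) n :
  \sum_(w < 8 * n) f w = \sum_(w < n) \sum_(c < 8) f (8 * w + c)%N.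
Proof.
elim: n => [|n IH]; first by rewrite muln0 !big_ord0.
by rewrite mulnS addnC big_split_ord /= IH [RHS]big_ord_recr.
Qed.

Section Walk.
Variable R : realType.
Implicit Types (p v e c : R) (F G : nat -> R).

(* [walk p K F s] is the mean of [F] after [K] steps of a walk started at [s]
   that moves to the right by 1 with probability [p] and stays otherwise. *)
Fixpoint walk p K F s : R :=
  if K is K'.+1 then p * walk p K' F s.+1 + (1 - p) * walk p K' F s else F s.

Lemma ler_walk p K F G s : 0 <= p <= 1 -> (forall s, F s <= G s) ->
  walk p K F s <= walk p K G s.
Proof.
move=> /andP[p0 p1] FG; elim: K s => [|K IH] s //=.
by apply: lerD; apply: ler_wpM2l; rewrite ?subr_ge0.
Qed.

Lemma walk_affine p K F a b s :
  walk p K (fun s => a + b * F s) s = a + b * walk p K F s.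
Proof. by elim: K s => //= K IH s; rewrite !IH; ring. Qed.

(** Binomial variance plus squared bias. *)
Lemma walk_sqr p K c s : walk p K (fun s => (s%:R - c) ^+ 2) s =
  K%:R * (p * (1 - p)) + (s%:R + K%:R * p - c) ^+ 2.
Proof.
elim: K s => [|K IH] s /=; first by rewrite !mul0r addr0 add0r.
by rewrite !IH -!natr1; ring.
Qed.

(** Chebyshev's argument: averaging the pointwise bound replaces the square by the variance, and
    [p * (1 - p) <= 1 / 4]. *)
Lemma walk_concentrate p K F v e c : 0 <= p <= 1 -> 0 <= c ->
  (forall s, `|F s - v| <= e + c * (s%:R - K%:R * p) ^+ 2) ->
  `|walk p K F 0 - v| <= e + c * K%:R / 4.
Proof.
move=> p01 c0 H.
set G := fun s : nat => (s%:R - K%:R * p) ^+ 2.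
have GE : walk p K G 0 <= K%:R / 4.
  rewrite walk_sqr add0r subrr expr0n addr0 ler_wpM2l // -subr_ge0.
  have -> : 4^-1 - p * (1 - p) = (p - 2^-1) ^+ 2 by field.
  exact: sqr_ge0.
have h1 s : F s <= (v + e) + c * G s.
  by have := H s; rewrite ler_norml /G => /andP[_]; lra.
have h2 s : (v - e) + (- c) * G s <= F s.
  by have := H s; rewrite ler_norml /G => /andP[+ _]; lra.
have := ler_walk K 0 p01 h1; have := ler_walk K 0 p01 h2.
rewrite !walk_affine; have := ler_wpM2l c0 GE; rewrite mulrA ler_norml.
by move=> *; apply/andP; split; lra.
Qed.

(** Digits 0 to 3 expand the factor [p] of a move, digits 4 to 7 the factor [1 - p] of a rest.
    Modulo 4, the residues 0 and 1 keep the frequency (the two halves of [2 * rcos]), while 2 and 3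
    raise [u] and [d]. Since [1 - p] carries [- sin t], the sign changes exactly at 6 and 7. *)
Definition digit_moved (c : nat) : nat := (c < 4)%N.
Definition digit_up (c : nat) : nat := (c %% 4 == 2)%N.
Definition digit_down (c : nat) : nat := (c %% 4 == 3)%N.
Definition digit_flip (c : nat) : nat := (5 < c)%N.

(* With [p = (1 + sin t) / 2], multiplying [rcos u d t] by [p] or [1 - p] gives
   a signed sum of four terms over 4; a base 8 digit records the choice. *)
Lemma walk_rcos K F s u d t :
  walk ((1 + sin t) / 2) K F s * rcos u d t =
  4 ^- K * \sum_(w < 8 ^ K) (-1) ^+ dsum digit_flip K w * F (s + dsum digit_moved K w)%N *
    rcos (u + dsum digit_up K w) (d + dsum digit_down K w) t.
Proof.
elim: K s u d => [|K IH] s u d.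
  rewrite expn0 big_ord1 /dsum !big_ord0 !addn0 !expr0 invr1 !mul1r //.
pose f K s u d (w : nat) := (-1) ^+ dsum digit_flip K w * F (s + dsum digit_moved K w)%N *
  rcos (u + dsum digit_up K w) (d + dsum digit_down K w) t.
rewrite expnS (sum_mul8 (f K.+1 s u d)) [walk _ _.+1 _ _]/= mulrDl.
have -> : forall a b : R, (1 + sin t) / 2 * a * rcos u d t +
   (1 - (1 + sin t) / 2) * b * rcos u d t =
   4^-1 * (a * (2 * rcos u d t + 2 * sin t * rcos u d t) +
    b * (2 * rcos u d t - 2 * sin t * rcos u d t)).
  by move=> a b; field.
rewrite sin_rcos.
have -> : forall a b x y z : R, 4^-1 * (a * (2 * x + (y + z)) + b * (2 * x - (y + z))) =
  4^-1 * (a * x + a * x + a * y + a * z + (b * x + b * x - b * y - b * z)).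
  by move=> *; field.
rewrite !IH.
have -> : forall e a b c x y z : R,
  4^-1 * (e * a + e * a + e * b + e * c + (e * x + e * x - e * y - e * z)) =
  4^-1 * e * (a + a + b + c + (x + x - y - z)) by move=> *; ring.
rewrite exprS invfM -!big_split -!sumrB -big_split /=; congr (_ * _).
apply: eq_bigr => w _.
rewrite 8!big_ord_recl big_ord0 /f /bump /=.
rewrite !dsumS //= /digit_moved /digit_up /digit_down /digit_flip /= !(add0n, addn0, addnS, addSn, add1n, expr0, exprS).
by ring.
Qed.

End Walk.


(** * Integrals of bounded measurable functions, and tails of a distribution *)

Section MeasurableBounded.
Variable R : realType.
Implicit Types f g : measurableTypeR R -> R.
Local Open Scope classical_set_scope.

Definition mbounded f :=
  measurable_fun setT f /\ exists M, forall x, `|f x| <= M.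

Lemma mbounded_cst c : mbounded (fun=> c).
Proof. by split; [exact: measurable_cst|exists `|c|]. Qed.

Lemma mboundedD f g : mbounded f -> mbounded g -> mbounded (fun x => f x + g x).
Proof.
move=> [mf [M fM]] [mg [N gN]]; split; first exact: measurable_funD.
by exists (M + N) => x; apply: le_trans (ler_normD _ _) (lerD _ _).
Qed.

Lemma mboundedM f g : mbounded f -> mbounded g -> mbounded (fun x => f x * g x).
Proof.
move=> [mf [M fM]] [mg [N gN]]; split; first exact: measurable_funM.
by exists (M * N) => x; rewrite normrM ler_pM.
Qed.

Lemma mboundedB f g : mbounded f -> mbounded g -> mbounded (fun x => f x - g x).
Proof.
move=> hf hg; have := mboundedD hf (mboundedM (mbounded_cst (-1)) hg).
by under eq_fun do rewrite mulN1r.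
Qed.

Lemma mbounded_sum n (F : nat -> measurableTypeR R -> R) :
  (forall i, mbounded (F i)) -> mbounded (fun x => \sum_(i < n) F i x).
Proof.
move=> hF; elim: n => [|n IH].
  by under eq_fun do rewrite big_ord0; exact: mbounded_cst.
by under eq_fun do rewrite big_ord_recr; exact: mboundedD.
Qed.

Lemma mbounded_cos t : mbounded (fun x => cos (t * x)).
Proof.
split; last by exists 1 => x; exact: cos_max.
apply: continuous_measurable_fun => x; apply: continuous_comp.
  exact: mulrl_continuous.
exact: continuous_cos.
Qed.

Lemma mbounded_sin t : mbounded (fun x => sin (t * x)).
Proof.
split; last by exists 1 => x; exact: sin_max.
apply: continuous_measurable_fun => x; apply: continuous_comp.
  exact: mulrl_continuous.
exact: continuous_sin.
Qed.

Lemma mbounded_indic (A : set (measurableTypeR R)) :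
  measurable A -> mbounded (\1_A : measurableTypeR R -> R).
Proof.
move=> mA; split; first exact: measurable_indic.
by exists 1 => x; rewrite indicE; case: (_ \in _); rewrite ?normr1 ?normr0.
Qed.

Lemma mbounded_walk (p : measurableTypeR R -> R) K F s :
  mbounded p -> mbounded (fun x => walk (p x) K F s).
Proof.
move=> hp; elim: K s => [|K IH] s /=; first exact: mbounded_cst.
apply: mboundedD; apply: mboundedM => //.
by apply: mboundedB => //; exact: mbounded_cst.
Qed.

Variable mu : probability (measurableTypeR R) R.

Lemma mbounded_integrable f : mbounded f -> mu.-integrable setT (EFin \o f).
Proof.
move=> [mf [M fM]]; apply: measurable_bounded_integrable => //.
  by have := ltry (1 : R); rewrite -(probability_setT mu).
by exists M; split; [exact: num_real|move=> y /ltW My x _ /=; exact: le_trans My].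
Qed.

Lemma Rintegral_mboundedD f g : mbounded f -> mbounded g ->
  \int[mu]_x (f x + g x) = \int[mu]_x f x + \int[mu]_x g x.
Proof. by move=> /mbounded_integrable ? /mbounded_integrable ?; exact: RintegralD. Qed.

Lemma Rintegral_mboundedB f g : mbounded f -> mbounded g ->
  \int[mu]_x (f x - g x) = \int[mu]_x f x - \int[mu]_x g x.
Proof. by move=> /mbounded_integrable ? /mbounded_integrable ?; exact: RintegralB. Qed.

Lemma Rintegral_mboundedZ c f : mbounded f ->
  \int[mu]_x (c * f x) = c * \int[mu]_x f x.
Proof. by move=> /mbounded_integrable ?; exact: RintegralZl. Qed.

Lemma le_Rintegral_mbounded f g : mbounded f -> mbounded g ->
  (forall x, f x <= g x) -> \int[mu]_x f x <= \int[mu]_x g x.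
Proof.
by move=> /mbounded_integrable ? /mbounded_integrable ? fg; exact: le_Rintegral.
Qed.

Lemma Rintegral_probability_cst c : \int[mu]_x c = c.
Proof.
rewrite Rintegral_cst // -[RHS]mulr1; congr (_ * _).
exact: (congr1 fine (probability_setT mu)).
Qed.

Lemma Rintegral_mbounded_sum n (F : nat -> measurableTypeR R -> R) :
  (forall i, mbounded (F i)) ->
  \int[mu]_x (\sum_(i < n) F i x) = \sum_(i < n) \int[mu]_x F i x.
Proof.
move=> hF; elim: n => [|n IH].
  by under eq_Rintegral do rewrite big_ord0; rewrite Rintegral_probability_cst big_ord0.
under eq_Rintegral do rewrite big_ord_recr /=.
by rewrite Rintegral_mboundedD ?IH ?big_ord_recr //; exact: mbounded_sum.
Qed.

Lemma Rintegral_indic (A : set (measurableTypeR R)) : measurable A ->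
  \int[mu]_x (\1_A x : R) = fine (mu A).
Proof. by move=> mA; rewrite /Rintegral integral_indic // setIT. Qed.

Lemma Rintegral_dist_le f g e c (A : set (measurableTypeR R)) :
  mbounded f -> mbounded g -> measurable A ->
  (forall x, `|f x - g x| <= e + c * \1_A x) ->
  `|\int[mu]_x f x - \int[mu]_x g x| <= e + c * fine (mu A).
Proof.
move=> hf hg mA fg.
have hA := mbounded_indic mA; have he := mbounded_cst e.
have hcA : mbounded (fun x => c * \1_A x) by exact: mboundedM (mbounded_cst c) hA.
have -> : e + c * fine (mu A) = \int[mu]_x (e + c * \1_A x).
  by rewrite Rintegral_mboundedD // Rintegral_mboundedZ // Rintegral_indic //
    Rintegral_probability_cst.
have hecA := mboundedD he hcA.
rewrite -Rintegral_mboundedB // ler_norml.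
have hfg := mboundedB hf hg.
apply/andP; split; last first.
  by apply: le_Rintegral_mbounded => // x; apply: le_trans (fg x); exact: ler_norm.
rewrite -mulN1r -Rintegral_mboundedZ //.
apply: le_Rintegral_mbounded => // [|x].
  exact: mboundedM (mbounded_cst _) hecA.
by have := fg x; rewrite ler_norml mulN1r => /andP[].
Qed.

Lemma measurable_norm_preimage (B : set R) : measurable B ->
  measurable ([set x | B `|x|] : set (measurableTypeR R)).
Proof.
by move=> mB; rewrite -[X in measurable X]setTI; exact: normr_measurable.
Qed.

Lemma measurable_norm_ge c : measurable ([set x | c <= `|x|] : set (measurableTypeR R)).
Proof.
rewrite (_ : mkset _ = [set x | `[c, +oo[ `|x|]); first exact: measurable_norm_preimage.
by apply/seteqP; split=> x /=; rewrite in_itv /= andbT.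
Qed.

Lemma measurable_norm_le c : measurable ([set x | `|x| <= c] : set (measurableTypeR R)).
Proof.
rewrite (_ : mkset _ = [set x | `]-oo, c] `|x|]); first exact: measurable_norm_preimage.
by apply/seteqP; split=> x /=; rewrite in_itv.
Qed.

(** The mean of [1 - cos (t * x)] over the nodes [t] is nonnegative everywhere and at least 1/2 on
    the annulus. The outer radius is there because finitely many nodes resolve only bounded [x]. *)
Lemma annulus_le q b (e : R) :
  (forall t : R, `|t| < 2 ^- q -> 1 - \int[mu]_x cos (t * x) <= e) ->
  fine (mu ([set x | 2 ^+ q.+2 <= `|x|] `&` [set x | `|x| <= 2 ^+ b])) <= 2 * e.
Proof.
move=> He; set A := _ `&` _.
have mA : measurable A.
  by apply: measurableI; [exact: measurable_norm_ge|exact: measurable_norm_le].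
(* The nodes [(2 * j + 1) * h] stay below [2 * N * h = 2 ^- q], where [He] applies. On the annulus
   [h * |x| <= 2 ^- q.+1 <= 1 / 2] and [N * h * |x| >= 2], as [sum_cos_odd_le] requires. *)
pose h : R := 2 ^- (b + q.+1); pose N := (2 ^ b)%N.
have h0 : 0 < h by rewrite invr_gt0 exprn_gt0.
have NE : N%:R = 2 ^+ b :> R by rewrite natrX.
have N0 : 0 < N%:R :> R by rewrite NE exprn_gt0.
have Nh : N%:R * h = 2 ^- q.+1.
  by rewrite NE /h exprD; field; rewrite !expf_neq0.
pose G (j : nat) x := cos ((j.*2.+1%:R * h) * x).
have hG j : mbounded (G j) by exact: mbounded_cos.
have hS : mbounded (fun x => \sum_(j < N) G j x) by exact: mbounded_sum.
have hA := mbounded_indic mA.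
have : \int[mu]_x (N%:R / 2 * \1_A x) <= \int[mu]_x (N%:R - \sum_(j < N) G j x).
  apply: le_Rintegral_mbounded => [||x].
  - exact: mboundedM (mbounded_cst _) hA.
  - exact: mboundedB (mbounded_cst _) hS.
  rewrite indicE; case: (boolP (x \in A)) => [|_]; last first.
    rewrite mulr0n mulr0 subr_ge0; apply: le_trans (_ : \sum_(j < N) (1 : R) <= _).
      by apply: ler_sum => j _; exact: cos_le1.
    by rewrite sumr_const card_ord.
  rewrite inE /A /= => -[x1 x2]; rewrite mulr1n mulr1.
  have -> : \sum_(j < N) G j x = \sum_(j < N) cos (j.*2.+1%:R * (h * x)).
    by apply: eq_bigr => j _; rewrite /G mulrA.
  suff : \sum_(j < N) cos (j.*2.+1%:R * (h * x)) <= N%:R / 2 by lra.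
  apply: sum_cos_odd_le; rewrite normrM (gtr0_norm h0).
    apply: le_trans (_ : h * 2 ^+ b <= _); first by rewrite ler_wpM2l // ltW.
    rewrite mulrC -NE Nh lef_pV2 ?posrE ?exprn_gt0 //.
    by rewrite -[X in X <= _]expr1 ler_eXn2l // ltr1n.
  rewrite mulrA Nh mulrC ler_pdivlMr ?exprn_gt0 // -exprS.
rewrite Rintegral_mboundedZ // Rintegral_indic // Rintegral_mboundedB //; last first.
  exact: mbounded_cst.
rewrite Rintegral_probability_cst Rintegral_mbounded_sum // => H.
have : N%:R - \sum_(j < N) \int[mu]_x G j x <= N%:R * e.
  have -> : N%:R = \sum_(j < N) (1 : R) by rewrite sumr_const card_ord.
  rewrite -sumrB mulr_suml; apply: ler_sum => j _; rewrite mul1r; apply: He.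
  rewrite ger0_norm ?mulr_ge0 ?ltW //.
  apply: lt_le_trans (_ : N.*2%:R * h <= _).
    by rewrite ltr_pM2r // ltr_nat -doubleS leq_double.
  by rewrite -muln2 natrM mulrAC Nh exprS invfM mulrAC mulVf ?mul1r.
rewrite -[_ <= 2 * e](ler_pM2l N0); lra.
Qed.

(** The bound on the annuli does not depend on the outer radius, so it passes to their increasing
    union. *)
Lemma tail_le q (e : R) :
  (forall t : R, `|t| < 2 ^- q -> 1 - \int[mu]_x cos (t * x) <= e) ->
  fine (mu [set x | 2 ^+ q.+2 <= `|x|]) <= 2 * e.
Proof.
move=> He.
pose F b : set (measurableTypeR R) :=
  [set x | 2 ^+ q.+2 <= `|x|] `&` [set x | `|x| <= 2 ^+ b].
have mF b : measurable (F b).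
  by apply: measurableI; [exact: measurable_norm_ge|exact: measurable_norm_le].
have FE : \bigcup_b F b = [set x | 2 ^+ q.+2 <= `|x|].
  apply/seteqP; split=> [x [b _ []] //|x /= hx].
  exists (Num.truncn `|x|).+1 => //; split=> //=.
  apply: le_trans (ltW (truncnS_gt _)) _.
  by rewrite ltW // natr_ltX2.
have := nondecreasing_cvg_mu mF (bigcup_measurable (fun k _ => mF k)).
rewrite FE => /(_ R mu) H.
rewrite -lee_fin fineK ?fin_num_measure //; last exact: measurable_norm_ge.
apply: (cvge_to_le (H _)).
  move=> m n mn; apply/subsetPset => x [/= x1 x2]; split=> //=.
  by apply: le_trans x2 _; rewrite ler_weXn2l // ler1n.
apply: nearW => b /=.
rewrite -(fineK (fin_num_measure mu _ (mF b))) lee_fin; exact: annulus_le.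
Qed.

End MeasurableBounded.


(** * Quantitative approximation of a compactly supported function *)

Section Approximation.
Variable R : realType.
Implicit Types (f : R -> R) (x y e : R).

(** The unit margin in [L.+1] exceeds or equals [2 ^- al]: if one point leaves the larger interval,
    both lie where [f] vanishes. *)
Lemma supported_modulus f L al e : 0 < e ->
  (forall x y, `|x| <= L.+1%:R -> `|y| <= L.+1%:R -> `|x - y| < 2 ^- al ->
    `|f x - f y| < e) ->
  (forall x, L%:R <= `|x| -> f x = 0) ->
  forall x y, `|x - y| < 2 ^- al -> `|f x - f y| < e.
Proof.
move=> e0 fe f0.
have h x y : `|x - y| < 2 ^- al -> L.+1%:R < `|x| -> L%:R <= `|x| /\ L%:R <= `|y|.
  have : 2 ^- al <= 1 :> R by rewrite -[leRHS]invr1 -(expr0 2) ler_invX2.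
  have := ler_normD (x - y) y; rewrite subrK -natr1.
  by move=> *; split; lra.
move=> x y xy.
have [xL|Lx] := leP `|x| L.+1%:R; last first.
  by have [? ?] := h x y xy Lx; rewrite !f0 // subrr normr0.
have [yL|Ly] := leP `|y| L.+1%:R; first exact: fe.
by rewrite distrC in xy; have [? ?] := h y x xy Ly; rewrite !f0 // subrr normr0.
Qed.

(** Going right from [x] in steps of [2 ^- al.+1], at most [2 * L * 2 ^ al.+1] of them reach the
    zeros of [f], and each changes [f] by less than 1. The bound is thus recursive in the data. *)
Lemma supported_bound f L al :
  (forall x y, `|x - y| < 2 ^- al -> `|f x - f y| < 1) ->
  (forall x, L%:R <= `|x| -> f x = 0) ->
  forall x, `|f x| <= (L * 2 * 2 ^ al.+1)%N%:R.
Proof.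
move=> f1 f0.
have H j x : L%:R - j%:R * 2 ^- al.+1 <= x -> `|f x| <= j%:R.
  elim: j x => [|j IH] x Lx.
    rewrite mul0r subr0 in Lx.
    by rewrite f0 ?normr0 //; apply: le_trans Lx (ler_norm _).
  have : `|f (x + 2 ^- al.+1)| <= j%:R.
    by apply: IH; move: Lx; rewrite -natr1; lra.
  have : `|f x - f (x + 2 ^- al.+1)| < 1.
    apply: f1; rewrite opprD addrA subrr sub0r normrN gtr0_norm ?invX2_gt0 //.
    by rewrite (invX2S _ al) ltrDl invX2_gt0.
  have := ler_normD (f x - f (x + 2 ^- al.+1)) (f (x + 2 ^- al.+1)).
  by rewrite subrK -natr1; lra.
move=> x; have [|Lx] := leP L%:R `|x|; first by move=> /f0 ->; rewrite normr0.
apply: H; rewrite !natrM natrX mulfK ?expf_neq0 //.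
by move: Lx; rewrite ltr_norml => /andP[+ _]; lra.
Qed.

(** Bernstein's proof of the Weierstrass theorem: a node near the target is handled by the modulus,
    a far one by [2 * M] times the squared ratio of its distance to [2 ^- al], which is at least 1.
    The node of state [s] is [2 ^ a * (2 * s / 2 ^ b - 1)]. *)
Lemma bernstein_sin f al e (M a b : nat) x :
  (forall x y, `|x - y| < 2 ^- al -> `|f x - f y| < e) ->
  (forall x, `|f x| <= M%:R) ->
  `|walk ((1 + sin (2 ^- a * x)) / 2) (2 ^ b)
      (fun s => f (((s * 2 ^ a.+1)%N%:R - (2 ^ (a + b))%N%:R) / 2 ^+ b)) 0
    - f (2 ^+ a * sin (2 ^- a * x))|
    <= e + 2 * M%:R * 4 ^+ (al + a) / 2 ^+ b.
Proof.
move=> fe fM.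
have e0 : 0 < e by have := fe 0 0; rewrite !subrr normr0; apply; exact: invX2_gt0.
set S := sin _; set p := (1 + S) / 2.
have p01 : 0 <= p <= 1.
  have := sin_le1 (2 ^- a * x); have := sin_geN1 (2 ^- a * x).
  by rewrite -/S /p => *; apply/andP; split; lra.
pose A : R := 2 ^+ a; pose B : R := 2 ^+ b; pose D : R := 2 ^+ al.
have A0 : 0 < A by rewrite exprn_gt0.
have B0 : 0 < B by rewrite exprn_gt0.
have D0 : 0 < D by rewrite exprn_gt0.
have M0 : 0 <= M%:R :> R by exact: ler0n.
(* This is [2 * M * D ^ 2] times the square of the factor [2 * A / B] that converts deviations of
   the walk into distances between nodes. *)
pose c := 8 * M%:R * D ^+ 2 * A ^+ 2 / B ^+ 2.
have c0 : 0 <= c by rewrite /c divr_ge0 ?sqr_ge0 // !mulr_ge0 ?sqr_ge0 ?(ltW D0, ltW A0).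
have KE : (2 ^ b)%N%:R = B by rewrite natrX.
have -> : 2 * M%:R * 4 ^+ (al + a) / 2 ^+ b = c * (2 ^ b)%N%:R / 4.
  rewrite KE /c -/B; have -> : 4 = 2 ^+ 2 :> R by ring.
  rewrite -exprM mulnC exprM exprD -/A -/D; field; exact: lt0r_neq0.
apply: walk_concentrate => // s.
set y := _ / 2 ^+ b; set v := 2 ^+ a * S.
have yv : y - v = 2 * A / B * (s%:R - (2 ^ b)%N%:R * p).
  rewrite /y /v natrM !natrX exprD exprS -/A -/B /p; field; exact: lt0r_neq0.
have [yv1|yv1] := ltP `|y - v| (2 ^- al).
  apply: ltW; apply: lt_le_trans (fe _ _ yv1) _.
  by rewrite lerDl mulr_ge0 // sqr_ge0.
have -> : c * (s%:R - (2 ^ b)%N%:R * p) ^+ 2 = 2 * M%:R * (D * (y - v)) ^+ 2.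
  by rewrite yv /c; field; exact: lt0r_neq0.
have h1 : 1 <= (D * (y - v)) ^+ 2.
  rewrite -[leRHS]ger0_norm ?sqr_ge0 // normrX normrM (gtr0_norm D0).
  apply: exprn_ege1.
  by have := ler_wpM2l (ltW D0) yv1; rewrite mulfV // lt0r_neq0.
apply: le_trans (ler_normB _ _) _; apply: le_trans (lerD (fM _) (fM _)) _.
have : 2 * M%:R * 1 <= 2 * M%:R * (D * (y - v)) ^+ 2.
  by rewrite ler_wpM2l // mulr_ge0.
by lra.
Qed.

Lemma natr_mulX2 M P : M%:R * 2 ^- (P + M) <= 2 ^- P :> R.
Proof.
rewrite exprD invfM mulrCA ler_piMr ?(ltW (invX2_gt0 _ _)) //.
by rewrite ler_pdivrMr ?exprn_gt0 // mul1r ltW // natr_ltX2.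
Qed.

(** For [|x| < 2 ^ q.+2] the choice of [a] gives [x ^ 2 / 2 ^ a <= 2 ^- al.+1], so replacing [x] by
    the scaled sine costs one [2 ^- P.+2]. The choice of [b] brings the Chebyshev term down to
    [M * 2 ^- (P.+2 + M)], at most a second one; the modulus inside the Bernstein estimate is the
    third. *)
Lemma bernstein_sin_near f al (M P q : nat) x :
  let a := (2 * q.+2 + al.+1)%N in
  let b := ((P.+2 + M).+1 + 2 * (al + a))%N in
  (forall x y, `|x - y| < 2 ^- al -> `|f x - f y| < 2 ^- P.+2) ->
  (forall x, `|f x| <= M%:R) ->
  `|walk ((1 + sin (2 ^- a * x)) / 2) (2 ^ b)
      (fun s => f (((s * 2 ^ a.+1)%N%:R - (2 ^ (a + b))%N%:R) / 2 ^+ b)) 0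
    - f x| <= 3 * 2 ^- P.+2 + 2 * M%:R * \1_[set x | 2 ^+ q.+2 <= `|x|]%classic x.
Proof.
move=> a b fe fM.
have M0 : 0 <= M%:R :> R by exact: ler0n.
have := bernstein_sin a b x fe fM; set w := walk _ _ _ _ => H.
have H1 : 2 * M%:R * 4 ^+ (al + a) / 2 ^+ b <= 2 ^- P.+2 :> R.
  have -> : 2 ^+ b = 2 * 2 ^+ (P.+2 + M) * 4 ^+ (al + a) :> R.
    by rewrite /b exprD exprM exprS; congr (_ * _ ^+ _); ring.
  apply: le_trans (natr_mulX2 M P.+2).
  rewrite le_eqVlt; apply/orP; left; apply/eqP; field.
  by rewrite !expf_neq0.
set y := 2 ^+ a * _ in H.
suff : `|f y - f x| <= 2 ^- P.+2 + 2 * M%:R * \1_[set x | 2 ^+ q.+2 <= `|x|]%classic x.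
  have := ler_normD (w - f y) (f y - f x); rewrite addrA subrK; lra.
rewrite indicE; case: (boolP (x \in _)) => [_|].
  rewrite mulr1n mulr1; apply: le_trans (ler_normB _ _) _.
  by have := fM x; have := fM y; have := invX2_gt0 R P.+2; lra.
rewrite notin_setE /= => /negP; rewrite -ltNge => xq.
rewrite mulr0n mulr0 addr0; apply: ltW; apply: fe.
have a0 : 0 < 2 ^+ a :> R by rewrite exprn_gt0.
have -> : y - x = 2 ^+ a * (sin (2 ^- a * x) - 2 ^- a * x).
  by rewrite mulrBr mulrA mulfV ?mul1r ?lt0r_neq0.
rewrite normrM (gtr0_norm a0).
apply: le_lt_trans (ler_wpM2l (ltW a0) (sin_near _)) _.
have -> : 2 ^+ a * (2 ^- a * x) ^+ 2 = 2 ^- a * `|x| ^+ 2.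
  by rewrite -normrX ger0_norm ?sqr_ge0 //; field; exact: lt0r_neq0.
apply: le_lt_trans (_ : 2 ^- al.+1 < _); last by rewrite (invX2S R al) ltrDl invX2_gt0.
rewrite /a exprD invfM mulrAC ler_piMl ?(ltW (invX2_gt0 _ _)) //.
rewrite mulrC ler_pdivrMr ?exprn_gt0 // mul1r mulnC exprM.
by rewrite lerXn2r ?nnegrE ?exprn_ge0 // ltW.
Qed.

End Approximation.

(** * The integrated approximant in terms of the characteristic function *)

Section WalkIntegral.
Variables (R : realType) (mu : probability (measurableTypeR R) R).

Lemma mbounded_rcos u d t : mbounded (fun x : measurableTypeR R => rcos u d (t * x)).
Proof.
rewrite /rcos; under eq_fun do rewrite !mulrA.
by apply: mboundedD; apply: mboundedM; try exact: mbounded_cst;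
  [exact: mbounded_cos|exact: mbounded_sin].
Qed.

Lemma Rintegral_rcos u d t : \int[mu]_x rcos u d (t * x) =
  quart R (u + 3 * d) * complex.Re (char_fun mu ((u%:R - d%:R) * t)) +
  quart' R (u + 3 * d) * complex.Im (char_fun mu ((u%:R - d%:R) * t)).
Proof.
rewrite /rcos; under eq_Rintegral do rewrite !mulrA.
have hc := mbounded_cos ((u%:R - d%:R) * t); have hs := mbounded_sin ((u%:R - d%:R) * t).
rewrite Rintegral_mboundedD ?Rintegral_mboundedZ //.
- exact: mboundedM (mbounded_cst _) hc.
- exact: mboundedM (mbounded_cst _) hs.
Qed.

Lemma Rintegral_walk_sin K F t :
  \int[mu]_x walk ((1 + sin (t * x)) / 2) K F 0 =
  4 ^- K * \sum_(w < 8 ^ K) (-1) ^+ dsum digit_flip K w * F (dsum digit_moved K w) *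
    \int[mu]_x rcos (dsum digit_up K w) (dsum digit_down K w) (t * x).
Proof.
have -> : (fun x => walk ((1 + sin (t * x)) / 2) K F 0) =
  (fun x => 4 ^- K * \sum_(w < 8 ^ K) (-1) ^+ dsum digit_flip K w * F (dsum digit_moved K w) *
     rcos (dsum digit_up K w) (dsum digit_down K w) (t * x)).
  apply/funext => x; have := walk_rcos K F 0 0 0 (t * x).
  (* The bare walk is expanded from frequency 0, where the cosine factor is 1. *)
  have -> : rcos 0 0 (t * x) = 1.
    by rewrite /rcos /quart /quart' /= subrr mul0r cos0 subr0 mulr1 sin0 mulr0 addr0.
  by rewrite mulr1.
pose G w x := (-1) ^+ dsum digit_flip K w * F (dsum digit_moved K w) *
  rcos (dsum digit_up K w) (dsum digit_down K w) (t * x).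
have hG w : mbounded (G w : measurableTypeR R -> R).
  by apply: mboundedM; [exact: mbounded_cst|exact: mbounded_rcos].
rewrite Rintegral_mboundedZ; last exact: (mbounded_sum (8 ^ K) hG).
rewrite (Rintegral_mbounded_sum mu (8 ^ K) hG); congr (_ * _).
apply: eq_bigr => w _; rewrite Rintegral_mboundedZ //; exact: mbounded_rcos.
Qed.

End WalkIntegral.


Lemma recf_family1 k f a : recursive (family1 f) -> recf k a ->
  recf k (fun s => f (a s)).
Proof.
move=> hf ha.
exact: (@recf_comp k 1 (fun s => f (nth 0 s 0)%N) _ hf (recl_cons ha (recl_nil k))).
Qed.

Lemma recf_family3 k f a b c : recursive (family3 f) ->
  recf k a -> recf k b -> recf k c -> recf k (fun s => f (a s) (b s) (c s)).
Proof.
move=> hf ha hb hc.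
exact: (@recf_comp k 3 (fun s => f (nth 0 s 0) (nth 0 s 1) (nth 0 s 2))%N _ hf
  (recl_cons ha (recl_cons hb (recl_cons hc (recl_nil k))))).
Qed.

Lemma recf_dsum k t K w : recf 1 (fun s => t (nth 0 s 0)%N) ->
  recf k K -> recf k w -> recf k (fun s => dsum t (K s) (w s)).
Proof.
move=> ht hK hw; have hw' := recf_behead hw.
have hd : recf k.+1 (fun s => (w (behead s) %/ 8 ^ nth 0 s 0) %% 8)%N by recf_tac.
have hF := recf_comp ht (recl_cons hd (recl_nil k.+1)).
exact: (recf_sum hF hK).
Qed.

Section CrealConstants.
Variable R : realType.

Lemma creal_sign k a : recf k a -> creal k (fun s => (-1) ^+ a s : R).
Proof.
move=> ha.
have h i : recf k (fun s => (a s %% 2 == i)%N : nat) by recf_tac.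
apply: (eq_creal (creal_int R (h 0%N) (h 1%N))) => s _.
by rewrite -signr_odd modn2; case: odd; rewrite /= ?sub0r ?subr0 ?expr0 ?expr1.
Qed.

Lemma creal_quart k a : recf k a -> creal k (fun s => quart R (a s)).
Proof. by move=> ha; apply: creal_int; recf_tac. Qed.

Lemma creal_quart' k a : recf k a -> creal k (fun s => quart' R (a s)).
Proof. by move=> ha; apply: creal_int; recf_tac. Qed.

Lemma creal_inv4X k a : recf k a -> creal k (fun s => 4 ^- a s : R).
Proof.
move=> ha.
have h : recf k (fun s => 2 * a s)%N by recf_tac.
apply: (eq_creal (creal_dyadic R (recf_const k 1) (recf_const k 0) h)) => s _.
rewrite subr0 div1r exprM; congr ((_ ^+ _)^-1); ring.
Qed.

End CrealConstants.

(** * Choice of parameters, error budget and computability of the integrals *)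

Section Assembly.
Variables (R : realType) (mu : nat -> probability (measurableTypeR R) R).
Variables (f : nat -> R -> R) (L : nat -> nat) (alf alc : nat -> nat -> nat -> nat).
Hypotheses (hRe : computable_fun (fun m t => complex.Re (char_fun (mu m) t)))
  (hIm : computable_fun (fun m t => complex.Im (char_fun (mu m) t)))
  (hf : computable_fun f) (hL : recursive (family1 L))
  (halc : recursive (family3 alc)) (half : recursive (family3 alf)).
Hypothesis alcP : forall n L k (x y : R), `|x| <= L%:R -> `|y| <= L%:R ->
  `|x - y| < 2 ^- alc n L k ->
  `|complex.Re (char_fun (mu n) x) - complex.Re (char_fun (mu n) y)| < 2 ^- k.
Hypothesis alfP : forall n L k (x y : R), `|x| <= L%:R -> `|y| <= L%:R ->
  `|x - y| < 2 ^- alf n L k -> `|f n x - f n y| < 2 ^- k.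
Hypothesis f0 : forall n x, (L n)%:R <= `|x| -> f n x = 0.

Let bnd n : nat := (L n * 2 * 2 ^ (alf n (L n).+1 0).+1)%N.
Let al P n : nat := alf n (L n).+1 P.+2.
(** The 1 bounds [|t|], as [|t| < 2 ^- q <= 1]. In the exponent, [bnd n] offsets the factor [bnd n]
    on the tail, and 4 provides the 1/16 of the error budget. *)
Let q P m n : nat := alc m 1 (P + bnd n + 4)%N.
Let a P m n : nat := (2 * (q P m n).+2 + (al P n).+1)%N.
Let b P m n : nat := ((P.+2 + bnd n).+1 + 2 * (al P n + a P m n))%N.
Let F P m n (s : nat) : R :=
  f n (((s * 2 ^ (a P m n).+1)%N%:R - (2 ^ (a P m n + b P m n))%N%:R) /
    2 ^+ b P m n).
Let g P m n x : R :=
  walk ((1 + sin (2 ^- a P m n * x)) / 2) (2 ^ b P m n) (F P m n) 0.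

Let f_modulus k n x y : `|x - y| < 2 ^- alf n (L n).+1 k ->
  `|f n x - f n y| < 2 ^- k.
Proof.
apply: (supported_modulus (invX2_gt0 R k) _ (f0 (n := n))) => {}x {}y.
exact: alfP.
Qed.

Let f_bound n x : `|f n x| <= (bnd n)%:R.
Proof.
apply: (supported_bound _ (f0 (n := n))) => {}x y.
by move=> /f_modulus; rewrite expr0 invr1.
Qed.

Let mbounded_f n : mbounded (f n).
Proof.
split; last by exists (bnd n)%:R => x; exact: f_bound.
apply: continuous_measurable_fun => x; apply/cvgrPdist_lt => e e0.
have [k ke] : exists k, 2 ^- k < e.
  exists (Num.truncn e^-1).+1.
  rewrite invf_plt ?posrE ?exprn_gt0 //; apply: lt_trans (truncnS_gt _) _.
  exact: natr_ltX2.
near=> y; apply: lt_trans ke; apply: f_modulus; near: y.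
by apply: cvgr_dist_lt; [exact: cvg_id|exact: invX2_gt0].
Unshelve. all: by end_near. Qed.

Let mbounded_g P m n : mbounded (g P m n).
Proof.
apply: mbounded_walk; apply: mboundedM; last exact: mbounded_cst.
by apply: mboundedD; [exact: mbounded_cst|exact: mbounded_sin].
Qed.

(** The bulk takes [3 * 2 ^- P.+2], three quarters of [2 ^- P]. The tail takes [2 * bnd n] times a
    mass of at most [2 * 2 ^- (P + bnd n) / 16], hence at most the last quarter. *)
Lemma g_approx P m n :
  `|\int[mu m]_x g P m n x - \int[mu m]_x f n x| <= 2 ^- P.
Proof.
have := bernstein_sin_near (q P m n) _ (@f_modulus P.+2 n) (@f_bound n).
move=> /(Rintegral_dist_le (mu m) (mbounded_g P m n) (mbounded_f n)
  (measurable_norm_ge _)) /le_trans; apply.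
have tail : fine (mu m [set x | 2 ^+ (q P m n).+2 <= `|x|]%classic) <=
    2 * 2 ^- (P + bnd n + 4).
  apply: tail_le => t tq.
  have t1 : `|t| <= 1.
    by apply/ltW/(lt_le_trans tq); rewrite -[leRHS]invr1 -(expr0 2) ler_invX2.
  (* The real part of the characteristic function is 1 at 0, so its modulus there bounds the
     integral of [1 - cos (t * x)]. *)
  have := @alcP m 1 (P + bnd n + 4) 0 t; rewrite normr0 sub0r normrN.
  move=> /(_ ler01 t1 tq); rewrite /char_fun /Cintegral /expi /=.
  under eq_Rintegral do rewrite mul0r cos0.
  by rewrite Rintegral_probability_cst ltr_norml => /andP[_ /ltW].
have E : 2 ^- (P + bnd n + 4) = 2 ^- (P + bnd n) / 16 :> R.
  by rewrite exprD invfM; congr (_ * _^-1); ring.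
have := ler_wpM2l (ler0n R (2 * bnd n)) tail; rewrite E natrM.
have := natr_mulX2 R (bnd n) P; have := invX2S R P; have := invX2S R P.+1.
lra.
Qed.

(** All arguments of [f] and of the characteristic function are dyadic with recursive numerators and
    exponents, so [creal_fun_dyadic] applies to both; the rest is closure under finite sums and
    products. *)
Lemma creal_g : creal 3 (fun s =>
  \int[mu (nth 0 s 1)%N]_x g (nth 0 s 0)%N (nth 0 s 1)%N (nth 0 s 2)%N x).
Proof.
have r k i : (i < k)%N -> recf k (fun s => nth 0 s i)%N by exact: recf_nth.
have rbnd k n : recf k n -> recf k (fun s => bnd (n s)).
  move=> hn; have hLn := recf_family1 hL hn.
  have := recf_family3 half hn (recf_succ hLn) (recf_const k 0).
  by move=> ?; rewrite /bnd; recf_tac.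
have ral k P n : recf k P -> recf k n -> recf k (fun s => al (P s) (n s)).
  move=> hP hn; have hLn := recf_family1 hL hn.
  by apply: (recf_family3 half); recf_tac.
have rq k P m n : recf k P -> recf k m -> recf k n ->
    recf k (fun s => q (P s) (m s) (n s)).
  move=> hP hm hn; have hB := rbnd _ _ hn.
  by apply: (recf_family3 halc); recf_tac.
have ra k P m n : recf k P -> recf k m -> recf k n ->
    recf k (fun s => a (P s) (m s) (n s)).
  move=> hP hm hn; have := rq _ _ _ _ hP hm hn; have := ral _ _ _ hP hn.
  by move=> ? ?; rewrite /a; recf_tac.
have rb k P m n : recf k P -> recf k m -> recf k n ->
    recf k (fun s => b (P s) (m s) (n s)).
  move=> hP hm hn; have := ra _ _ _ _ hP hm hn; have := ral _ _ _ hP hn.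
  by have := rbnd _ _ hn; move=> ? ? ?; rewrite /b; recf_tac.
pose K s : nat := (2 ^ b (nth 0 s 0) (nth 0 s 1) (nth 0 s 2))%N.
have hK : recf 3 K by apply: recf_exp; [exact: recf_const|apply: rb; exact: r].
have hK' := recf_behead hK.
(* Inside the sum the word [w] is prepended, which moves [P], [m], [n] to positions 1, 2, 3. *)
have hP : recf 4 (fun s => nth 0 s 1)%N by exact: r.
have hm : recf 4 (fun s => nth 0 s 2)%N by exact: r.
have hn : recf 4 (fun s => nth 0 s 3)%N by exact: r.
have ha := ra _ _ _ _ hP hm hn; have hb := rb _ _ _ _ hP hm hn.
have hw : recf 4 (fun s => nth 0 s 0)%N by exact: r.
have dig t : recf 1 (fun s => t (nth 0 s 0)%N) ->
    recf 4 (fun s => dsum t (K (behead s)) (nth 0 s 0)%N).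
  by move=> ht; apply: recf_dsum.
have h0 : recf 1 (fun s => nth 0 s 0)%N by exact: r.
have hmoved : recf 4 (fun s => dsum digit_moved (K (behead s)) (nth 0 s 0)%N).
  by apply: dig; apply: recf_leq; recf_tac.
have hflip : recf 4 (fun s => dsum digit_flip (K (behead s)) (nth 0 s 0)%N).
  by apply: dig; apply: recf_leq; recf_tac.
have hup : recf 4 (fun s => dsum digit_up (K (behead s)) (nth 0 s 0)%N).
  by apply: dig; apply: recf_eqn; recf_tac.
have hdown : recf 4 (fun s => dsum digit_down (K (behead s)) (nth 0 s 0)%N).
  by apply: dig; apply: recf_eqn; recf_tac.
pose u s := dsum digit_up (K (behead s)) (nth 0 s 0)%N.
pose d s := dsum digit_down (K (behead s)) (nth 0 s 0)%N.
have hud : recf 4 (fun s => u s + 3 * d s)%N by rewrite /u /d; recf_tac.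
have hF := creal_fun_dyadic hf hn
  (recf_mul hmoved (recf_exp (recf_const 4 2) (recf_succ ha)))
  (recf_exp (recf_const 4 2) (recf_add ha hb)) hb.
have hC := creal_fun_dyadic hRe hm hup hdown ha.
have hS := creal_fun_dyadic hIm hm hup hdown ha.
have hsum := creal_mul (creal_mul (creal_sign R hflip) hF)
  (creal_add (creal_mul (creal_quart R hud) hC) (creal_mul (creal_quart' R hud) hS)).
have h8K : recf 3 (fun s => 8 ^ K s)%N by recf_tac.
apply: (eq_creal (creal_mul (creal_inv4X R hK) (creal_sum hsum h8K))) => s _.
rewrite /g Rintegral_walk_sin; congr (_ * _); apply: eq_bigr => w _.
by rewrite Rintegral_rcos.
Qed.

Lemma creal_integral :
  creal 2 (fun s => \int[mu (nth 0 s 0)%N]_x f (nth 0 s 1)%N x).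
Proof.
by apply: (creal_lim creal_g) => s P _; exact: g_approx.
Qed.

End Assembly.

Theorem theorem4p5 (R : realType)
    (mu : nat -> probability (measurableTypeR R) R) :
  computable_cfun (fun m => char_fun (mu m)) -> computable_distr mu.
Proof.
move=> [hRe hIm] f [hf [L [hL f0]]].
have [_ [alc [halc alcP]]] := hRe; have [_ [alf [half alfP]]] := hf.
exact: computable_of_creal (creal_integral hRe hIm hf hL halc half alcP alfP f0).
Qed.
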